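(* Let $k>1$ and let $\alpha(y_1,\dots,y_k)=c\oplus y_1\oplus\cdots\oplus y_k$, with $c\in GF(2)$, be a linear $k$-adic connective. Consider the growth process $(\mu,\alpha)$ on $n$ variables and assume that the support of $\mu$ does not contain negations of the projections. (1) If $\{0,1\}\cap\mathrm{supp}(\mu)\neq\{0,1\}$ (i.e. at least one of the two constant functions is missing from the support of $\mu$), $k$ is odd and $c=1$, then the growth process has alternating limiting distributions, each of which is uniform over one half of the support of the growth process (which consists of all linear functions $c_0\oplus c_1x_1\oplus\cdots\oplus c_nx_n$ for which $\bigoplus_{j=1}^n c_j=1$). (2) In all other cases, the limiting distribution is uniform over the support of the growth process (which depends on $k$, $c$, and the presence of constants in the support of $\mu$).
   Context: A connective is a $k$-adic Boolean function $\alpha:\{0,1\}^k\to\{0,1\}$. Let $A_0=\{x_1,\dots,x_n,\bar x_1,\dots,\bar x_n,0,1\}$ be the set of projections on $n$ variables, their negations, and the two constant functions. The initial distribution $\mu$ is the uniform distribution on a subset of $A_0$ which contains the $n$ projections, may or may not contain their $n$ negations, and contains neither, one, or both constants. The growth process $(\mu,\alpha)$ gives distributions $\pi_i$ on $n$-adic Boolean functions: $\pi_0=\mu$, and for $i\ge1$, $\pi_i(f)$ is the probability that $\alpha(g_1,\dots,g_k)=f$ where $g_1,\dots,g_k$ are independent random functions distributed according to $\pi_{i-1}$. The support of a distribution $\pi$ is $\mathrm{supp}(\pi)=\{f: \pi(f)>0\}$; the support of the growth process is the set of all functions $f$ with $\pi_i(f)>0$ for some $i>0$. The limiting distribution is $\pi=\lim_{i\to\infty}\pi_i$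 (pointwise) when it exists. The process has alternating limiting distributions if $\pi_{2i}$ and $\pi_{2i+1}$ tend to distinct distributions as $i\to\infty$. A function is linear if it has the form $c_0\oplus c_1x_1\oplus\cdots\oplus c_nx_n$ with $c_0,c_1,\dots,c_n\in GF(2)$.
   Formalization: In (1), the support is all linear functions with c_1⊕…⊕c_n=1 only when no constant is in supp(μ); when exactly one constant is present, that description is false and is replaced by: the support consists of all linear functions. *)

(* Defs.v *)
From mathcomp Require Import all_boot all_order all_algebra.
From mathcomp Require Import all_classical all_reals all_analysis.
Import Order.TTheory GRing.Theory Num.Theory.
Import numFieldNormedType.Exports.

Set Implicit Arguments.
Unset Strict Implicit.
Unset Printing Implicit Defensive.

Local Open Scope ring_scope.
Local Open Scope set_scope.

(* GF(2) is represented by [bool], with [addb] (written (+)) as addition and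
   [andb] as multiplication. *)

Definition boolfun (n : nat) : finType := {ffun {ffun 'I_n -> bool} -> bool}.

Definition compose (k n : nat) (alpha : boolfun k)
    (g : {ffun 'I_k -> boolfun n}) : boolfun n :=
  [ffun x : {ffun 'I_n -> bool} => alpha [ffun j => g j x]].

Definition const_fun (n : nat) (b : bool) : boolfun n :=
  [ffun _ : {ffun 'I_n -> bool} => b].

Definition projection (n : nat) (i : 'I_n) : boolfun n :=
  [ffun x : {ffun 'I_n -> bool} => x i].

Definition neg_projection (n : nat) (i : 'I_n) : boolfun n :=
  [ffun x : {ffun 'I_n -> bool} => ~~ x i].

Definition constants (n : nat) : {set boolfun n} :=
  [set const_fun n false; const_fun n true].

Definition projections (n : nat) : {set boolfun n} :=
  [set projection i | i : 'I_n].

Definition neg_projections (n : nat) : {set boolfun n} :=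
  [set neg_projection i | i : 'I_n].

Definition A0 (n : nat) : {set boolfun n} :=
  projections n :|: neg_projections n :|: constants n.

Definition linear_fun (n : nat) (c0 : bool) (c : {ffun 'I_n -> bool}) :
    boolfun n :=
  [ffun x : {ffun 'I_n -> bool} =>
     c0 (+) \big[addb/false]_(j < n) (c j && x j)].

Definition linear_functions (n : nat) : {set boolfun n} :=
  [set linear_fun u.1 u.2 | u : bool * {ffun 'I_n -> bool}].

Definition odd_linear_functions (n : nat) : {set boolfun n} :=
  [set linear_fun u.1 u.2 | u : bool * {ffun 'I_n -> bool}
     & \big[addb/false]_(j < n) u.2 j].

Definition linear_connective (k : nat) (c : bool) : boolfun k :=
  [ffun y : {ffun 'I_k -> bool} => c (+) \big[addb/false]_(j < k) y j].

Definition uniform_on (R : realType) (T : finType) (A : {set T}) :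
    {ffun T -> R} :=
  [ffun f => if f \in A then #|A|%:R^-1 else 0].

Definition supp (R : realType) (T : finType) (p : {ffun T -> R}) : {set T} :=
  [set f | 0 < p f].

Definition initial_distribution (R : realType) (n : nat)
    (mu : {ffun boolfun n -> R}) : Prop :=
  exists A : {set boolfun n},
    [/\ A \subset A0 n,
        projections n \subset A,
        (neg_projections n \subset A) || [disjoint neg_projections n & A]
      & mu = uniform_on R A].

(* The sum ranges over the outcomes (g_1, ..., g_k) with
   alpha(g_1, ..., g_k) = f; the product is the probability of such an outcome
   under k independent draws. *)
Fixpoint growth (R : realType) (n k : nat) (mu : {ffun boolfun n -> R})
    (alpha : boolfun k) (i : nat) : {ffun boolfun n -> R} :=
  match i with
  | 0%N => mu
  | i'.+1 =>
      [ffun f => \sum_(g : {ffun 'I_k -> boolfun n} | compose alpha g == f)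
                   \prod_(j < k) growth mu alpha i' (g j)]
  end.

Definition growth_support (R : realType) (n k : nat)
    (mu : {ffun boolfun n -> R}) (alpha : boolfun k) : {set boolfun n} :=
  [set f | `[< exists2 i : nat, (0 < i)%N & f \in supp (growth mu alpha i) >]].

Definition tends_to (R : realType) (T : finType) (p : nat -> {ffun T -> R})
    (q : {ffun T -> R}) : Prop :=
  forall f : T, (p i f @[i --> \oo] --> q f)%classic.

Definition alternating_limits (R : realType) (T : finType)
    (p : nat -> {ffun T -> R}) (q0 q1 : {ffun T -> R}) : Prop :=
  [/\ tends_to (fun i => p (2 * i)%N) q0,
      tends_to (fun i => p (2 * i + 1)%N) q1
    & q0 <> q1].

Definition halves (T : finType) (S H0 H1 : {set T}) : Prop :=
  [/\ H0 :|: H1 = S, [disjoint H0 & H1] & #|H0| = #|H1|].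

(* Main.v *)
(* Boolean functions form a vector space over GF(2), whose characters are
   f |-> (-1)^<y, f>.  One step of the process multiplies the Fourier transform
   at y by (-1)^<y, c> after raising it to the power k.  Let A be the support of
   the initial distribution.  If <y, .> is constant on A, the transform at y has
   absolute value 1 and its sign is the one of the process started from a single
   element of A; otherwise it has absolute value less than 1 initially and tends
   to 0.  This is the limiting behaviour of the transform of the uniform
   distribution on a coset, moving with i, of the span of the sums of pairs of
   elements of A.  The coset oscillates between two values exactly when k is
   odd, c = 1 and the constant 1 is not in that span. *)

Require Import Defs.
From mathcomp Require Import all_boot all_order all_algebra.
From mathcomp Require Import all_classical all_reals all_analysis.
Import Order.TTheory GRing.Theory Num.Theory.
Import numFieldNormedType.Exports.

Set Implicit Arguments.
Unset Strict Implicit.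
Unset Printing Implicit Defensive.

Local Open Scope ring_scope.
Local Open Scope set_scope.

(** * The GF(2) pairing, cosets and the Fourier transform *)

Definition pairing (T : finType) (y f : {ffun T -> bool}) : bool :=
  \big[addb/false]_x (y x && f x).

Definition xorf (T : finType) (f g : {ffun T -> bool}) : {ffun T -> bool} :=
  [ffun x => f x (+) g x].

(** These [y] form the annihilator of the span of the pairwise sums of [A]. *)
Definition const_on (T : finType) (A : {set {ffun T -> bool}})
    (y : {ffun T -> bool}) : bool :=
  [forall a in A, forall b in A, pairing y a == pairing y b].

(* By biduality, the coset of [b] modulo the group spanned by the pairwise sums
   of elements of [A]. *)
Definition coset (T : finType) (A : {set {ffun T -> bool}})
    (b : {ffun T -> bool}) : {set {ffun T -> bool}} :=
  [set f | [forall y, const_on A y ==> (pairing y f == pairing y b)]].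

Definition fourier (R : realType) (T : finType)
    (p : {ffun {ffun T -> bool} -> R}) (y : {ffun T -> bool}) : R :=
  \sum_f (-1) ^+ pairing y f * p f.

Lemma big_addb_const (k : nat) (b : bool) :
  \big[addb/false]_(j < k) b = odd k && b.
Proof.
elim: k => [|k IHk]; first by rewrite big_ord0.
by rewrite big_ord_recl IHk /=; case: (odd k); case: b {IHk}.
Qed.

(** Reindexing by [h] shows that the sum is its own opposite. This serves both the orthogonality of
    characters and the vanishing of character sums over cosets. *)
Lemma sum_sign_reversing (R : realType) (I : finType) (P : pred I)
    (F : I -> R) (h : I -> I) :
  involutive h -> (forall x, P (h x) = P x) ->
  (forall x, P x -> F (h x) = - F x) ->
  \sum_(x | P x) F x = 0.
Proof.
move=> hK Ph Fh; set s := LHS.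
suff /eqP : s = - s by rewrite -addr_eq0 -mulr2n mulrn_eq0 => /eqP.
rewrite {1}/s (reindex_inj (inv_inj hK)) /= -sumrN.
by under eq_bigl do rewrite Ph; apply: eq_bigr.
Qed.

(** * Bilinearity of the pairing; translation of cosets *)

Section Pairing.
Variable T : finType.
Implicit Types (y f g b : {ffun T -> bool}) (A : {set {ffun T -> bool}}).

Lemma pairing_xor y f g : pairing y (xorf f g) = pairing y f (+) pairing y g.
Proof.
rewrite /pairing -big_split /=; apply: eq_bigr => x _.
by rewrite ffunE andb_addr.
Qed.

Lemma pairingC y f : pairing y f = pairing f y.
Proof. by apply: eq_bigr => x _; rewrite andbC. Qed.

Lemma pairing_delta x f : pairing [ffun z => z == x] f = f x.
Proof.
rewrite /pairing (bigD1 x) //= ffunE eqxx /= big1 ?addbF // => z /negbTE zx.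
by rewrite ffunE zx.
Qed.

Lemma xorfK g : involutive (xorf g).
Proof. by move=> f; apply/ffunP => x; rewrite !ffunE addKb. Qed.

Lemma const_onP A y :
  reflect {in A &, forall a b, pairing y a = pairing y b} (const_on A y).
Proof.
apply: (iffP forall_inP) => [h a b aA bA|h a aA].
  exact/eqP/(forall_inP (h a aA)).
by apply/forall_inP => b bA; apply/eqP/h.
Qed.

Lemma cosetP A b f :
  reflect (forall y, const_on A y -> pairing y f = pairing y b)
          (f \in coset A b).
Proof.
rewrite inE; apply: (iffP forallP) => h y; first by move/(implyP (h y))/eqP.
by apply/implyP => /h ->.
Qed.

Lemma mem_coset A b : b \in coset A b.
Proof. exact/cosetP. Qed.

Lemma eq_coset A b f : f \in coset A b -> coset A f = coset A b.
Proof.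
move=> /cosetP fb; apply/setP => g.
by apply/cosetP/cosetP => h y yA; rewrite h // fb.
Qed.

Lemma xor_coset A g f b :
  (xorf g f \in coset A (xorf g b)) = (f \in coset A b).
Proof.
apply/cosetP/cosetP => h y /h; rewrite !pairing_xor; last by move=> ->.
exact: addbI.
Qed.

(** By symmetry one inequality is enough, and translation by [xorf b b'] injects one coset into the
    other. *)
Lemma card_coset A b b' : #|coset A b| = #|coset A b'|.
Proof.
wlog le : b b' / (#|coset A b| <= #|coset A b'|)%N.
  by move=> h; case/orP: (leq_total #|coset A b| #|coset A b'|) => /h.
apply/eqP; rewrite eqn_leq le /=.
have [c cb] : exists c, xorf c b' = b.
  by exists (xorf b b'); apply/ffunP => x; rewrite !ffunE addbK.
rewrite -(card_imset _ (inv_inj (xorfK c)));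
apply/subset_leq_card/fintype.subsetP => _ /imsetP[f fb ->].
by rewrite -cb xor_coset.
Qed.

End Pairing.

(** * Fourier inversion and transforms of uniform distributions *)

Section Fourier.
Variables (R : realType) (T : finType).
Implicit Types (p : {ffun {ffun T -> bool} -> R}) (y f g b : {ffun T -> bool}).
Implicit Types (A : {set {ffun T -> bool}}).

(** After exchanging the sums, orthogonality of characters leaves only the term of [p f]. *)
Lemma fourier_inversion p f :
  \sum_y (-1) ^+ pairing y f * fourier p y = #|{ffun T -> bool}|%:R * p f.
Proof.
under eq_bigr do rewrite mulr_sumr.
rewrite exchange_big (bigD1 f) //= [X in _ + X]big1 ?addr0 => [|g gf].
  under eq_bigr do rewrite mulrA -signr_addb addbb mul1r.
  by rewrite sumr_const mulr_natl.
have [x gx] : exists x, g x != f x.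
  apply/existsP; rewrite -negb_forall; apply: contra gf => /forallP h.
  by apply/eqP/ffunP => x; apply/eqP.
(* Flipping [y] at a point [x] where [g] and [f] differ changes exactly one of the two signs. *)
apply: (sum_sign_reversing (xorfK [ffun z => z == x])) => // y _.
rewrite ![pairing (xorf _ _) _]pairingC !pairing_xor.
rewrite ![pairing _ [ffun z => _]]pairingC.
rewrite !pairing_delta ![pairing _ y]pairingC !signr_addb.
case: (g x) (f x) gx => [] [] //= _;
  by rewrite !expr0 !expr1 !(mulN1r, mul1r, mulrN, mulNr).
Qed.

Lemma fourier_uniform_on A y :
  fourier (uniform_on R A) y = (\sum_(f in A) (-1) ^+ pairing y f) / #|A|%:R.
Proof.
rewrite /fourier (bigID (mem A)) /= [X in _ + X]big1 => [|f /negbTE fA].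
  rewrite addr0 mulr_suml; apply: eq_bigr => f fA.
  by rewrite ffunE fA.
by rewrite ffunE fA mulr0.
Qed.

Lemma fourier_uniform_const A y s : A != finset.set0 ->
  {in A, forall f, pairing y f = s} ->
  fourier (uniform_on R A) y = (-1) ^+ s.
Proof.
move=> A0 ys; rewrite fourier_uniform_on.
rewrite (eq_bigr (fun=> (-1) ^+ s)) => [|f /ys-> //].
by rewrite sumr_const -(mulr_natr ((-1) ^+ s)) mulfK // pnatr_eq0 cards_eq0.
Qed.

Lemma fourier_coset A b y :
  fourier (uniform_on R (coset A b)) y =
  if const_on A y then (-1) ^+ pairing y b else 0.
Proof.
case: ifPn => yA.
  apply: fourier_uniform_const => [|f /cosetP]; last by apply.
  by apply/set0Pn; exists b; apply: mem_coset.
have [a aA [a' a'A aa']] : exists2 a, a \in A & exists2 a', a' \in A &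
    pairing y a != pairing y a'.
  move: yA; rewrite negb_forall_in => /exists_inP[a aA].
  by rewrite negb_forall_in => /exists_inP[a' a'A ?]; exists a => //; exists a'.
rewrite fourier_uniform_on.
(* Translation by [xorf a a'] preserves the coset, and it reverses the sign because [y] separates
   [a] from [a']. *)
rewrite (sum_sign_reversing (xorfK (xorf a a'))) ?mul0r // => f.
  apply/cosetP/cosetP => h z zA; have := h z zA; rewrite !pairing_xor;
    by rewrite (const_onP _ _ zA a a') // addbb.
move=> _; rewrite !pairing_xor signr_addb.
by case: (pairing y a) (pairing y a') aa' => [] [] // _; rewrite mulN1r.
Qed.

(** Two elements of [A] with opposite signs cancel, so at most [#|A| - 2] remains of the sum in
    absolute value. *)
Lemma norm_fourier_uniform_lt1 A y : ~~ const_on A y ->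
  `|fourier (uniform_on R A) y| < 1.
Proof.
rewrite negb_forall_in => /exists_inP[a aA].
rewrite negb_forall_in => /exists_inP[b bA ab].
have A_gt0 : (0 < #|A|)%N by apply/card_gt0P; exists a.
rewrite fourier_uniform_on normrM normfV normr_nat ltr_pdivrMr ?ltr0n // mul1r.
have ba : b != a by apply: contraNneq ab => ->.
rewrite (bigD1 a) //= (bigD1 b) ?bA //= addrA.
have -> : (-1) ^+ pairing y a + (-1) ^+ pairing y b = 0 :> R.
  by case: (pairing y a) (pairing y b) ab => [] [] //= _; rewrite ?addNr ?addrN.
rewrite add0r; apply: (le_lt_trans (ler_norm_sum _ _ _)).
rewrite -[X in _ < X%:R]sum1_card natr_sum [X in _ < X](bigD1 a) //=.
rewrite [X in _ < _ + X](bigD1 b) ?bA //= addrA.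
under eq_bigr do rewrite normr_sign.
by rewrite ltrDr.
Qed.

End Fourier.

(** * The growth step in Fourier coordinates and convergence to a moving coset *)

Section Growth.
Variables (R : realType) (n k : nat).
Implicit Types (mu : {ffun boolfun n -> R}) (c : bool) (a f : boolfun n).

Lemma pairing_compose (y : boolfun n) c (g : {ffun 'I_k -> boolfun n}) :
  pairing y (compose (linear_connective k c) g) =
  pairing y (const_fun n c) (+) \big[addb/false]_(j < k) pairing y (g j).
Proof.
rewrite /pairing exchange_big -big_split /=; apply: eq_bigr => x _.
rewrite !ffunE andb_addr big_distrr /=; congr (_ (+) _).
by apply: eq_bigr => j _; rewrite ffunE.
Qed.

(** The transform is an expected sign. The sign of a sum is the product of the signs, and the [k]
    draws are independent. *)
Lemma fourier_growthS mu c i (y : boolfun n) :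
  fourier (growth mu (linear_connective k c) i.+1) y =
  (-1) ^+ pairing y (const_fun n c) *
  fourier (growth mu (linear_connective k c) i) y ^+ k.
Proof.
set alpha := linear_connective k c; set p := growth mu alpha i.
transitivity (\sum_(g : {ffun 'I_k -> boolfun n})
    (-1) ^+ pairing y (compose alpha g) * \prod_(j < k) p (g j)).
  rewrite (partition_big (compose alpha) xpredT) //=; apply: eq_bigr => f _.
  rewrite ffunE mulr_sumr; by apply: eq_bigr => g /eqP ->.
under eq_bigr do rewrite pairing_compose signr_addb -mulrA.
rewrite -mulr_sumr; congr (_ * _).
(* The [k]-th power of a sum over functions expands into a sum over all [k]-tuples [g]. *)
rewrite -[k in RHS]card_ord -prodr_const bigA_distr_bigA /=.
apply: eq_bigr => g _; rewrite big_split /=; congr (_ * _).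
by rewrite (big_morph (fun b : bool => (-1) ^+ b) (@signr_addb R)
  (erefl : (-1) ^+ false = 1 :> R)).
Qed.

(** Induction on supports. Asking for nonzero rather than positive values avoids any sign condition
    on [mu]. *)
Lemma growth_neq0_ind mu (alpha : boolfun k) (P : nat -> pred (boolfun n)) :
  (forall f, mu f != 0 -> P 0%N f) ->
  (forall i (g : {ffun 'I_k -> boolfun n}),
     (forall j, P i (g j)) -> P i.+1 (compose alpha g)) ->
  forall i f, growth mu alpha i f != 0 -> P i f.
Proof.
move=> P0 PS; elim=> [//|i IHi] f; rewrite ffunE => sum_neq0.
have [g /andP[/eqP <- prod_neq0]] : exists g : {ffun 'I_k -> boolfun n},
    (compose alpha g == f) && (\prod_(j < k) growth mu alpha i (g j) != 0).
  apply/existsP; apply: contraNT sum_neq0; rewrite negb_exists => /forallP h.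
  rewrite big1 // => g gf; have := h g; rewrite gf /=.
  by rewrite negbK => /eqP.
by apply: PS => j; apply/IHi; move/prodf_neq0: prod_neq0 => /(_ j isT).
Qed.

(* The process started from the point mass at [a]. *)
Definition center c a (i : nat) : boolfun n :=
  iter i (fun f => compose (linear_connective k c)
                           [ffun _ : 'I_k => f]) a.

Lemma pairing_centerS c a i y :
  pairing y (center c a i.+1) =
  pairing y (const_fun n c) (+) (odd k && pairing y (center c a i)).
Proof.
rewrite pairing_compose -big_addb_const; congr (_ (+) _).
by apply: eq_bigr => j _; rewrite ffunE.
Qed.

Variables (A : {set boolfun n}) (a0 : boolfun n).
Hypothesis a0A : a0 \in A.

(** For [y] constant on [A], all possible draws at step [i] pair with [y] as the center does, so
    their composition pairs as the next center. *)
Lemma growth_coset c i f :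
  growth (uniform_on R A) (linear_connective k c) i f != 0 ->
  f \in coset A (center c a0 i).
Proof.
apply: (growth_neq0_ind (P := fun i f => f \in coset A (center c a0 i))).
  move=> {}f; rewrite ffunE; case: ifP => [fA _|_]; last by rewrite eqxx.
  by apply/cosetP => y /const_onP; apply.
move=> {}i g gP; apply/cosetP => y yA; rewrite pairing_centerS pairing_compose.
rewrite -big_addb_const; congr (_ (+) _); apply: eq_bigr => j _.
by have /cosetP := gP j; apply.
Qed.

Lemma fourier_growth_const_on c i (y : boolfun n) : const_on A y ->
  fourier (growth (uniform_on R A) (linear_connective k c) i) y =
  (-1) ^+ pairing y (center c a0 i).
Proof.
move=> yA; elim: i => [|i IHi].
  apply: fourier_uniform_const => [|f fA]; first by apply/set0Pn; exists a0.
  exact: (const_onP _ _ yA).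
rewrite fourier_growthS IHi pairing_centerS signr_addb; congr (_ * _).
by rewrite -exprM -[LHS]signr_odd oddM oddb andbC.
Qed.

Lemma norm_fourier_growth c i (y : boolfun n) :
  `|fourier (growth (uniform_on R A) (linear_connective k c) i) y| =
  `|fourier (uniform_on R A) y| ^+ (k ^ i).
Proof.
elim: i => [//|i IHi].
by rewrite fourier_growthS normrM normr_sign mul1r normrX IHi -exprM expnSr.
Qed.

(** A difference tending to 0 is used because the coset may oscillate with [i]. By Fourier inversion
    on a finite space, convergence of each transform suffices. *)
Lemma growth_uniform_coset c f : (1 < k)%N ->
  (growth (uniform_on R A) (linear_connective k c) i f
     - uniform_on R (coset A (center c a0 i)) f
   @[i --> \oo] --> (0 : R))%classic.
Proof.
move=> k_gt1.
set p := growth _ _; pose q i := uniform_on R (coset A (center c a0 i)).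
set N : R := #|{ffun {ffun 'I_n -> bool} -> bool}|%:R.
have N_neq0 : N != 0.
  by rewrite pnatr_eq0 -lt0n; apply/card_gt0P; exists f.
have fourier0 (y : boolfun n) :
    (fourier (p i) y - fourier (q i) y @[i --> \oo] --> (0 : R))%classic.
  have [yA|yA] := boolP (const_on A y).
    under eq_fun do
      rewrite fourier_growth_const_on // fourier_coset yA subrr.
    exact: cvg_cst.
  under eq_fun do rewrite fourier_coset (negbTE yA) subr0.
  apply/norm_cvg0P; under eq_fun do rewrite norm_fourier_growth.
  have r_lt1 := norm_fourier_uniform_lt1 R yA.
  set r := `|_| in r_lt1 *.
  have r_ge0 : 0 <= r by apply: normr_ge0.
  (* The transform has absolute value [r ^+ (k ^ i)], at most [r ^+ i] since [r < 1] and
     [i < k ^ i]. *)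
  apply: (@squeeze_cvgr _ _ _ _ (fun=> 0) (fun i => r ^+ i)).
  - apply: nearW => i; rewrite exprn_ge0 //=.
    by apply: ler_wiXn2l => //; [exact: ltW|exact/ltnW/ltn_expl].
  - exact: cvg_cst.
  - by apply: cvg_expr; rewrite ger0_norm.
have -> : (fun i => p i f - q i f) = (fun i => N^-1 *
     \sum_(y : boolfun n)
        (-1) ^+ pairing y f * (fourier (p i) y - fourier (q i) y)).
  apply/funext => i; under eq_bigr do rewrite mulrBr.
  by rewrite sumrB !fourier_inversion -mulrBr mulKf.
rewrite -[X in (_ --> X)%classic](mulr0 N^-1).
apply: cvgMr.
rewrite -[X in (_ --> X)%classic]
  (@big1_eq R 0 +%R _ (index_enum (boolfun n)) xpredT).
apply: cvg_big => [|y _]; first exact: add_continuous.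
rewrite -[X in (_ --> X)%classic](mulr0 ((-1) ^+ pairing y f)).
exact: cvgMr.
Qed.

End Growth.

(** * Supports, explicit centers and limits along subsequences *)

Section Support.
Variables (R : realType) (n k : nat).
Implicit Types (mu : {ffun boolfun n -> R}) (c d : bool) (a f : boolfun n).

Lemma supp_uniform_on (T : finType) (A : {set T}) :
  supp (uniform_on R A) = A.
Proof.
apply/setP => f; rewrite inE ffunE; case: ifP => fA; last by rewrite ltxx.
by rewrite invr_gt0 ltr0n; apply/card_gt0P; exists f.
Qed.

Lemma uniform_on_inj (T : finType) : injective (@uniform_on R T).
Proof. by move=> A B /(congr1 (@supp R T)); rewrite !supp_uniform_on. Qed.

Lemma growth_supportP mu (alpha : boolfun k) f :
  f \in growth_support mu alpha <->
  exists2 i : nat, (0 < i)%N & 0 < growth mu alpha i f.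
Proof.
rewrite inE; split.
  by move=> /asboolP[i i0]; rewrite inE; exists i.
by move=> [i i0 fi]; apply/asboolP; exists i => //; rewrite inE.
Qed.

(** A positive limit forces positive mass at some late step. The map [phi] allows limits along the
    even or the odd steps. *)
Lemma sub_growth_support mu (alpha : boolfun k) (phi : nat -> nat)
    (B : {set boolfun n}) :
  (forall i, (i <= phi i)%N) ->
  tends_to (fun i => growth mu alpha (phi i)) (uniform_on R B) ->
  B \subset growth_support mu alpha.
Proof.
move=> phi_ge lim; apply/fintype.subsetP => f fB; apply/growth_supportP.
have lim_gt0 : 0 < uniform_on R B f.
  by have := supp_uniform_on B => /setP/(_ f); rewrite inE fB.
have [N _ pos] := cvgr_gt _ (lim f) _ lim_gt0.
(* The successor makes the step positive, since the growth support leaves out step 0. *)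
exists (phi N.+1); first exact: leq_trans (phi_ge _).
by apply: pos => /=; apply: leqnSn.
Qed.

(** An odd number of equal arguments sums to one of them, so each step only adds [c]. *)
Lemma center_odd c a i : odd k ->
  center k c a i = if odd i && c then xorf (const_fun n true) a else a.
Proof.
move=> kodd; elim: i => [//|i IHi] /=; rewrite [LHS]/= -/(center k c a i) IHi.
apply/ffunP => x; rewrite !ffunE.
under eq_bigr do rewrite !ffunE.
rewrite big_addb_const kodd /=.
by case: (odd i); case: c {IHi}; rewrite /= ?ffunE ?negbK.
Qed.

(** An even number of equal arguments cancels, so the starting point is forgotten after one step. *)
Lemma center_even c a i : ~~ odd k -> center k c a i.+1 = const_fun n c.
Proof.
move=> keven; rewrite [LHS]/= -/(center k c a i).
apply/ffunP => x; rewrite !ffunE.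
under eq_bigr do rewrite !ffunE.
by rewrite big_addb_const (negbTE keven) addbF.
Qed.

(** Index 0 is exempt because for even [k] the center is stationary only from step 1 on. *)
Lemma tends_to_coset (A : {set boolfun n}) a0 c (phi : nat -> nat)
    (B : {set boolfun n}) : (1 < k)%N -> a0 \in A ->
  (forall i, (i <= phi i)%N) ->
  (forall i, (0 < i)%N -> coset A (center k c a0 (phi i)) = B) ->
  tends_to (fun i => growth (uniform_on R A) (linear_connective k c) (phi i))
           (uniform_on R B).
Proof.
move=> k_gt1 a0A phi_ge phiB f; apply/subr_cvg0.
have phi_infty : (phi i @[i --> \oo] --> \oo)%classic.
  move=> P [N _ NP]; exists N => // i /= Ni.
  by apply: NP => /=; apply: leq_trans (phi_ge i).
have := cvg_comp _ _ phi_infty (@growth_uniform_coset R _ _ _ _ a0A c f k_gt1).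
apply: cvg_trans.
apply: near_eq_cvg; exists 1%N => // i /= i_gt0.
by rewrite phiB.
Qed.

End Support.

(** * Linear functions and their closure under the connective *)

Section Linear.
Variables (n : nat).
Implicit Types (A : {set boolfun n}) (c d : bool) (f : boolfun n).

Lemma pairing_linear_fun (y : boolfun n) c (u : {ffun 'I_n -> bool}) :
  pairing y (linear_fun c u) = (c && pairing y (const_fun n true)) (+)
    \big[addb/false]_(j < n) (u j && pairing y (projection j)).
Proof.
under [in RHS]eq_bigr do rewrite big_distrr /=.
rewrite exchange_big big_distrr /= -big_split /=; apply: eq_bigr => x _.
rewrite !ffunE andb_addr andbT andbC big_distrr /=; congr (_ (+) _).
by apply: eq_bigr => j _; rewrite ffunE andbCA.
Qed.

Lemma projection_linear (j : 'I_n) :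
  projection j = linear_fun false [ffun i => i == j].
Proof.
apply/ffunP => x; rewrite !ffunE (bigD1 j) //= ffunE eqxx big1 ?addbF //.
by move=> i /negbTE ij; rewrite ffunE ij.
Qed.

Lemma const_linear c : const_fun n c = linear_fun c [ffun=> false].
Proof.
by apply/ffunP => x; rewrite !ffunE big1 ?addbF // => i _; rewrite ffunE.
Qed.

Lemma compose_linear_fun k c (u : 'I_k -> bool * {ffun 'I_n -> bool})
    (g : {ffun 'I_k -> boolfun n}) :
  (forall j, g j = linear_fun (u j).1 (u j).2) ->
  compose (linear_connective k c) g =
  linear_fun (c (+) \big[addb/false]_(j < k) (u j).1)
             [ffun i => \big[addb/false]_(j < k) (u j).2 i].
Proof.
move=> gE; apply/ffunP => x; rewrite !ffunE -addbA; congr (_ (+) _).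
under eq_bigr do rewrite ffunE gE ffunE.
rewrite big_split /=; congr (_ (+) _); rewrite exchange_big /=.
by apply: eq_bigr => i _; rewrite ffunE big_distrl.
Qed.

Lemma compose_in_linear k c (g : {ffun 'I_k -> boolfun n}) :
  (forall j, g j \in linear_functions n) ->
  compose (linear_connective k c) g \in linear_functions n.
Proof.
move=> gL.
have /fin_all_exists[u gE] : forall j, exists u : bool * {ffun 'I_n -> bool},
    g j = linear_fun u.1 u.2.
  by move=> j; case/imsetP: (gL j) => u; exists u.
rewrite (compose_linear_fun c gE).
by apply/imsetP; eexists (_, _).
Qed.

(** The coefficient parity of the result is a sum of [k] ones, which is 1 for odd [k]. *)
Lemma compose_in_odd_linear k c (g : {ffun 'I_k -> boolfun n}) : odd k ->
  (forall j, g j \in odd_linear_functions n) ->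
  compose (linear_connective k c) g \in odd_linear_functions n.
Proof.
move=> kodd gL.
have /fin_all_exists[u gE] : forall j, exists u : bool * {ffun 'I_n -> bool},
    \big[addb/false]_(i < n) u.2 i /\ g j = linear_fun u.1 u.2.
  by move=> j; case/imsetP: (gL j) => u; rewrite inE; exists u.
rewrite (@compose_linear_fun _ c u) => [|j]; last by have [] := gE j.
apply/imsetP; eexists (_, _) => //=; rewrite inE /=.
under eq_bigr do rewrite ffunE.
rewrite exchange_big /= (eq_bigr (fun=> true)) => [|j _];
  last by have [] := gE j.
by rewrite big_addb_const kodd.
Qed.

End Linear.

(** * The initial support and the two cosets through [a0] and its negation *)

Section Initial.
Variables (n : nat) (A : {set boolfun n}) (i0 : 'I_n).
Hypothesis A_proj : projections n \subset A.
Hypothesis A_sub : A \subset projections n :|: constants n.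

Lemma projection_in j : projection j \in A.
Proof. by apply: (fintype.subsetP A_proj); apply: imset_f. Qed.

Lemma in_initial f : f \in A ->
  (exists j, f = projection j) \/
  (exists2 d, f = const_fun n d & const_fun n d \in A).
Proof.
move=> fA; have := fintype.subsetP A_sub _ fA.
rewrite finset.in_setU => /orP[/imsetP[j _ ->]|]; first by left; exists j.
by rewrite !inE => /orP[] /eqP fE; right; rewrite fE in fA *;
  [exists false|exists true].
Qed.

(* If the constant [d] is missing then all of [A] takes the value [~~ d] at the
   point with all coordinates [~~ d], while the constants do not agree there. *)
Lemma const_on_missing d : const_fun n d \notin A ->
  exists2 y, const_on A y & pairing y (const_fun n true).
Proof.
move=> dA; pose y : boolfun n := [ffun z => z == [ffun=> ~~ d]].
exists y; last by rewrite pairing_delta ffunE.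
have pE f : f \in A -> pairing y f = ~~ d.
  rewrite pairing_delta => /in_initial[[j ->]|[e -> eA]];
    first by rewrite !ffunE.
  have ed : e != d by apply: contraNneq dA => <-.
  by rewrite ffunE; case: (e) (d) ed => [] [].
by apply/const_onP => f g fA gA; rewrite !pE.
Qed.

Let a0 := projection i0.
Let a1 := xorf (const_fun n true) a0.

(** The constant 1 is the sum of the two constants, hence lies in the span, and adding it fixes
    every coset. *)
Lemma cosets_constants : constants n \subset A -> coset A a1 = coset A a0.
Proof.
move=> /fintype.subsetP cA; apply: eq_coset; apply/cosetP => y /const_onP yA.
rewrite pairing_xor (yA _ (const_fun n false)) ?cA ?inE ?eqxx ?orbT //.
by rewrite /pairing [X in X (+) _]big1 // => x _; rewrite ffunE andbF.
Qed.

(** The [y] given by the missing constant takes different values on the two cosets. *)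
Lemma disjoint_cosets d : const_fun n d \notin A ->
  [disjoint coset A a0 & coset A a1].
Proof.
move=> /const_on_missing[y yA y1]; apply/pred0P => f /=; apply/negP.
move=> /andP[/cosetP/(_ _ yA) e /cosetP/(_ _ yA)]; rewrite e pairing_xor y1.
by case: (pairing y a0).
Qed.

Lemma pairing_const (y : boolfun n) d :
  pairing y (const_fun n d) = d && pairing y (const_fun n true).
Proof.
rewrite /pairing big_distrr /=; apply: eq_bigr => x _.
by rewrite !ffunE andbT andbC.
Qed.

Lemma pairing_projections (y : boolfun n) (u : {ffun 'I_n -> bool}) :
  const_on A y ->
  \big[addb/false]_(j < n) (u j && pairing y (projection j)) =
  \big[addb/false]_(j < n) u j && pairing y a0.
Proof.
move=> /const_onP yA; rewrite big_distrl /=; apply: eq_bigr => j _.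
by rewrite (yA _ a0) ?projection_in.
Qed.

(** For [y] constant on [A] all projections pair as [a0], so an odd number of them also does; the
    constant term selects the coset. *)
Lemma odd_linear_in_cosets :
  odd_linear_functions n \subset coset A a0 :|: coset A a1.
Proof.
apply/fintype.subsetP => f /imsetP[[c u]]; rewrite inE /= => uodd ->.
have E y : const_on A y ->
    pairing y (linear_fun c u) =
    (c && pairing y (const_fun n true)) (+) pairing y a0.
  by move=> yA; rewrite pairing_linear_fun pairing_projections // uodd.
rewrite finset.in_setU; case: c E => E; apply/orP; [right|left];
  apply/cosetP => y /E ->.
  by rewrite pairing_xor.
by [].
Qed.

Lemma linear_in_cosets d : const_fun n d \in A ->
  linear_functions n \subset coset A a0 :|: coset A a1.
Proof.
move=> dA; apply/fintype.subsetP => _ /imsetP[[c u] _ ->] /=.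
set b := \big[addb/false]_(j < n) u j.
(* Modulo the span, [a0] equals the constant [d]. If the number of projections is even, the sum 0 is
   written as [a0] plus [d], whence the correction [d && ~~ b]. *)
have E y : const_on A y -> pairing y (linear_fun c u) =
    ((c (+) (d && ~~ b)) && pairing y (const_fun n true)) (+) pairing y a0.
  move=> yA; rewrite pairing_linear_fun pairing_projections //.
  have -> : pairing y a0 = d && pairing y (const_fun n true).
    rewrite -pairing_const; apply: (const_onP _ _ yA) => //.
    by apply: projection_in.
  by rewrite -/b; case: (c) (d) (b) (pairing y _) => [] [] [] [].
rewrite finset.in_setU; case: (c (+) _) E => E; apply/orP; [right|left];
  apply/cosetP => y /E ->.
  by rewrite pairing_xor.
by [].
Qed.

Lemma initial_linear : A \subset linear_functions n.
Proof.
apply/fintype.subsetP => f /in_initial[[j ->]|[d -> _]].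
  rewrite projection_linear; apply/imsetP.
  by exists (false, [ffun i => i == j]).
by rewrite const_linear; apply/imsetP; exists (d, [ffun=> false]).
Qed.

Lemma initial_odd_linear : [disjoint constants n & A] ->
  A \subset odd_linear_functions n.
Proof.
move=> dis; apply/fintype.subsetP => f /in_initial[[j ->]|[d _ dA]].
  rewrite projection_linear; apply/imsetP.
  exists (false, [ffun i => i == j]) => //.
  rewrite inE /= (bigD1 j) //= ffunE eqxx big1 // => i /negbTE ij.
  by rewrite ffunE ij.
have := disjointFl dis dA; rewrite !inE.
by case: d {dA}; rewrite eqxx ?orbT.
Qed.

End Initial.

(** * Limits and supports in the convergent and alternating cases *)

Section Limits.
Variables (R : realType) (n k : nat) (A : {set boolfun n}) (i0 : 'I_n).
Hypothesis k_gt1 : (1 < k)%N.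
Hypothesis A_proj : projections n \subset A.
Hypothesis A_sub : A \subset projections n :|: constants n.

Let a0 := projection i0.
Let a1 := xorf (const_fun n true) a0.
Let a0A : a0 \in A := projection_in A_proj i0.
Let process c := growth (uniform_on R A) (linear_connective k c).
Let S c := growth_support (uniform_on R A) (linear_connective k c).

Lemma support_ind c (P : pred (boolfun n)) :
  {in A, forall f, P f} ->
  (forall g : {ffun 'I_k -> boolfun n}, (forall j, P (g j)) ->
     P (compose (linear_connective k c) g)) ->
  S c \subset P.
Proof.
move=> PA PS; apply/fintype.subsetP => f /growth_supportP[i _ /lt0r_neq0].
apply: (growth_neq0_ind (P := fun=> P)) => // {}f; rewrite ffunE.
by case: ifP => [fA _|_]; [exact: PA|rewrite eqxx].
Qed.

Lemma support_coset c f : f \in S c ->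
  exists2 i, (0 < i)%N & f \in coset A (center k c a0 i).
Proof.
by move=> /growth_supportP[i i_gt0 /lt0r_neq0 fi]; exists i => //;
  apply: growth_coset fi.
Qed.

(** The support is [B]: each positive step stays inside [B], and the limit is positive on all of
    it. *)
Lemma tends_to_support c B :
  (forall i, (0 < i)%N -> coset A (center k c a0 i) = B) ->
  tends_to (process c) (uniform_on R (S c)).
Proof.
move=> cB; have lim : tends_to (process c) (uniform_on R B).
  by apply: (tends_to_coset (phi := id) k_gt1 a0A _ cB) => i.
suff -> : S c = B by [].
apply/eqP; rewrite finset.eqEsubset.
rewrite (sub_growth_support (phi := id) (fun=> leqnn _) lim).
by rewrite andbT; apply/fintype.subsetP => f /support_coset[i /cB ->].
Qed.

Lemma convergent_growth c :
  ~~ [&& constants n :&: A != constants n, odd k & c] ->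
  tends_to (process c) (uniform_on R (S c)).
Proof.
have [kodd|keven _] := boolP (odd k); last first.
  apply: (@tends_to_support _ (coset A (const_fun n c))) => -[//|i] _.
  by rewrite center_even.
move=> /= cond; apply: (@tends_to_support _ (coset A a0)) => i _.
(* The center moves only if [c] is 1; then both constants lie in [A] and its coset stays the
   same. *)
rewrite center_odd //; case: ifP => // /andP[_ c1].
apply: cosets_constants => //; move: cond; rewrite c1 andbT negbK => /eqP <-.
exact: finset.subsetIr.
Qed.

(** The center alternates between [a0] and [a1], whose cosets are disjoint because a constant is
    missing. *)
Lemma alternating_growth :
  constants n :&: A != constants n -> odd k ->
  [/\ halves (S true) (coset A a0) (coset A a1) &
      alternating_limits (process true)
        (uniform_on R (coset A a0)) (uniform_on R (coset A a1))].
Proof.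
move=> cA kodd.
have [d dA] : exists d, const_fun n d \notin A.
  apply/existsP; rewrite -negb_forall; apply: contra cA => /forallP cA.
  apply/eqP/finset.setIidPl/fintype.subsetP => f.
  by rewrite !inE => /orP[] /eqP ->.
have dis : [disjoint coset A a0 & coset A a1] by apply: disjoint_cosets dA.
have lim0 :
    tends_to (fun i => process true (2 * i)%N) (uniform_on R (coset A a0)).
  apply: (tends_to_coset (phi := muln 2) k_gt1 a0A) => i.
    by rewrite mul2n -addnn leq_addr.
  by move=> _; rewrite center_odd // mul2n odd_double.
have lim1 :
    tends_to (fun i => process true (2 * i + 1)%N) (uniform_on R (coset A a1)).
  apply: (tends_to_coset (phi := fun i => (2 * i + 1)%N) k_gt1 a0A) => i.
    by rewrite mul2n -addnn -addnA leq_addr.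
  by move=> _; rewrite center_odd // mul2n addn1 /= odd_double.
split; split=> //.
- apply/eqP; rewrite finset.eqEsubset finset.subUset.
  rewrite (sub_growth_support (phi := muln 2) _ lim0); last first.
    by move=> i; rewrite mul2n -addnn leq_addr.
  rewrite (sub_growth_support (phi := fun i => (2 * i + 1)%N) _ lim1);
    last first.
    by move=> i; rewrite mul2n -addnn -addnA leq_addr.
  apply/fintype.subsetP => f /support_coset[i _]; rewrite center_odd // andbT.
  by rewrite finset.in_setU; case: (odd i) => ->; rewrite ?orbT.
- exact: card_coset.
- move=> /(@uniform_on_inj R _) e; have /pred0P/(_ a0) := dis.
  by rewrite -e /= mem_coset.
Qed.

(** One inclusion is closure under the connective; the other holds because the two halves cover all
    odd linear functions. *)
Lemma support_odd_linear :
  constants n :&: A != constants n -> odd k -> [disjoint constants n & A] ->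
  S true = odd_linear_functions n.
Proof.
move=> cA kodd dis; apply/eqP; rewrite finset.eqEsubset; apply/andP; split.
  apply: support_ind => [|g]; last exact: compose_in_odd_linear.
  exact/fintype.subsetP/initial_odd_linear.
have [[<- _ _] _] := alternating_growth cA kodd.
exact: odd_linear_in_cosets.
Qed.

Lemma support_linear :
  constants n :&: A != constants n -> odd k -> ~~ [disjoint constants n & A] ->
  S true = linear_functions n.
Proof.
move=> cA kodd /pred0Pn[f /andP[fc fA]].
have [d dA] : exists d, const_fun n d \in A.
  move: fc; rewrite !inE => /orP[] /eqP fE; rewrite fE in fA;
    by [exists false|exists true].
apply/eqP; rewrite finset.eqEsubset; apply/andP; split.
  apply: support_ind => [|g]; last exact: compose_in_linear.
  exact/fintype.subsetP/initial_linear.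
have [[<- _ _] _] := alternating_growth cA kodd.
exact: linear_in_cosets dA.
Qed.

End Limits.

Theorem theorem3p2 (R : realType) (n k : nat) (c : bool)
    (mu : {ffun boolfun n -> R}) (n_gt0 : (0 < n)%N) (k_gt1 : (1 < k)%N)
    (mu_init : initial_distribution mu)
    (mu_noneg : forall i : 'I_n, neg_projection i \notin supp mu) :
  let alpha := linear_connective k c in
  let S := growth_support mu alpha in
  let case1 := [&& constants n :&: supp mu != constants n, odd k & c] in
  (case1 ->
     (exists H0 H1 : {set boolfun n},
        halves S H0 H1 /\
        alternating_limits (growth mu alpha)
          (uniform_on R H0) (uniform_on R H1)) /\
     ([disjoint constants n & supp mu] -> S = odd_linear_functions n) /\
     (~~ [disjoint constants n & supp mu] -> S = linear_functions n)) /\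
  (~~ case1 -> tends_to (growth mu alpha) (uniform_on R S)).
Proof.
case: mu_init => A [A_sub A_proj _ muE]; subst mu.
move: mu_noneg; rewrite !supp_uniform_on => noneg.
have {}A_sub : A \subset projections n :|: constants n.
  apply/fintype.subsetP => f fA; have := fintype.subsetP A_sub _ fA.
  rewrite !finset.in_setU => /orP[/orP[->//|/imsetP[i _ fE]]|->];
    last by rewrite orbT.
  by have := noneg i; rewrite -fE fA.
(* A projection exists and serves as base point of the cosets. *)
pose i0 := Ordinal n_gt0.
split; last exact: (convergent_growth i0).
move=> /and3P[cA kodd c1]; rewrite c1; split; [|split].
- have [halvesS lims] := alternating_growth R i0 k_gt1 A_proj A_sub cA kodd.
  by eexists; eexists; split; [exact: halvesS|exact: lims].
- exact: (support_odd_linear R i0).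
- exact: (support_linear R i0).
Qed.
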